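(* There exists an atomic Puiseux monoid $M$ such that the monoid algebra $\mathbb{Z}_2[x;M]$ is not atomic.
   Context: $\mathbb{Z}_2$ denotes the field with two elements. A Puiseux monoid is a submonoid of $(\mathbb{Q}_{\ge 0}, +)$. An atom of $M$ is a nonzero element $a$ such that $a = x+y$ with $x,y\in M$ implies $x=0$ or $y=0$; $M$ is atomic if every nonzero element is a finite sum of atoms. $\mathbb{Z}_2[x;M]$ is the ring of finitely supported functions $M \to \mathbb{Z}_2$ (written $\sum_s f(s)x^s$) with convolution product, an integral domain; it is atomic if every nonzero nonunit is a finite product of irreducible elements. *)

(* Defs.v *)
From HB Require Import structures.
From mathcomp Require Import all_boot all_order all_algebra.
From mathcomp Require Import finmap.
Set Implicit Arguments. Unset Strict Implicit. Unset Printing Implicit Defensive.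
Import Order.TTheory GRing.Theory Num.Theory.
Local Open Scope ring_scope.

Definition puiseux_monoid (M : rat -> Prop) : Prop :=
  [/\ M 0,
      (forall x y, M x -> M y -> M (x + y)) &
      (forall x, M x -> 0 <= x)].

Definition monoid_atom (M : rat -> Prop) (a : rat) : Prop :=
  [/\ M a, a != 0 &
      forall x y, M x -> M y -> a = x + y -> x = 0 \/ y = 0].

Definition atomic_monoid (M : rat -> Prop) : Prop :=
  forall x, M x -> x != 0 ->
    exists s : seq rat, (forall a, a \in s -> monoid_atom M a) /\ x = \sum_(a <- s) a.

(* Elements of Z_2[x;M]: a finitely supported function f : M -> Z_2 is
   determined by its (finite) support, so we represent
   sum_s f(s) x^s by its support, a finite set of rationals contained in M. *)
Definition in_alg (M : rat -> Prop) (f : {fset rat}) : Prop :=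
  forall s, s \in f -> M s.

Definition conv_coef (f g : {fset rat}) (s : rat) : 'F_2 :=
  \sum_(a <- f) \sum_(b <- g) ((a + b == s)%:R : 'F_2).

Definition alg_mul (f g : {fset rat}) : {fset rat} :=
  [fset s in [fset (a + b)%R | a in f, b in g]%fset | conv_coef f g s != 0]%fset.

Definition alg_one : {fset rat} := [fset (0 : rat)]%fset.
Definition alg_zero : {fset rat} := fset0.

Definition alg_prod (l : seq {fset rat}) : {fset rat} := foldr alg_mul alg_one l.

Definition alg_unit (M : rat -> Prop) (f : {fset rat}) : Prop :=
  in_alg M f /\ exists g, in_alg M g /\ alg_mul f g = alg_one.

Definition alg_irreducible (M : rat -> Prop) (f : {fset rat}) : Prop :=
  [/\ in_alg M f, f != alg_zero, ~ alg_unit M f &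
      forall g h, in_alg M g -> in_alg M h -> f = alg_mul g h ->
        alg_unit M g \/ alg_unit M h].

Definition alg_atomic (M : rat -> Prop) : Prop :=
  forall f, in_alg M f -> f != alg_zero -> ~ alg_unit M f ->
    exists l : seq {fset rat},
      (forall g, g \in l -> alg_irreducible M g) /\ f = alg_prod l.

(* Main.v *)
Require Import Defs.
From mathcomp Require Import all_boot all_order all_algebra all_field.
From mathcomp Require Import finmap.
From mathcomp Require Import zify ring lra.
Set Implicit Arguments. Unset Strict Implicit. Unset Printing Implicit Defensive.
Import Order.TTheory GRing.Theory Num.Theory.
Local Open Scope ring_scope.

(** Let M be generated by the rationals 2^-n - 3^-l_n and 2^-n + 3^-l_n, where
    l_n grows so fast that, for size reasons, a relation among generators has
    too small coefficients to cancel the powers of 3 in the denominators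
    3-adically; hence all generators are atoms.  The two generators of index
    n+1 add up to 2^-n, so M contains all dyadic rationals, and M is contained
    in Z[1/6].
    Let g divide 1 + x + x^2 in Z_2[x;M].  In the variable y = x^(1/6^k) the
    latter is (y^(2 3^k) + y^(3^k) + 1)^(2^k), and the base is the 3^(k+1)-th
    cyclotomic polynomial, irreducible because 2 is a primitive root modulo
    3^(k+1).  So g is a power of it, its exponents are dyadic, and halving them
    gives a square root of g that again lies in Z_2[x;M].  Thus 1 + x + x^2 has
    no irreducible divisor. *)

(** * The order of 2 modulo powers of 3 *)

(** The 3-adic valuation of 2^(2 3^l) - 1 is exactly l+1; the stronger unit part 3v+1 is what
    survives the cubing in the induction. *)
Lemma expn2_3adic l : exists v, (2 ^ (2 * 3 ^ l) = 1 + 3 ^ l.+1 * (3 * v + 1))%N.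
Proof.
elim: l => [|l [v IH]]; first by exists 0%N; rewrite muln1.
have -> : (2 ^ (2 * 3 ^ l.+1) = (2 ^ (2 * 3 ^ l)) ^ 3)%N.
  by rewrite -expnM expnS; congr (_ ^ _)%N; lia.
rewrite IH !expnS; move: (3 ^ l)%N => t.
(* With c = 3v+1, this reads off (1 + 3tc)^3 = 1 + 9t (c + 3tc^2 + 3t^2c^3). *)
exists (v + t * (3 * v + 1) ^ 2 + t ^ 2 * (3 * v + 1) ^ 3)%N.
by ring.
Qed.

Lemma expn1D_mod_sqr t u e : exists w, ((1 + t * u) ^ e = 1 + e * (t * u) + t ^ 2 * w)%N.
Proof.
elim: e => [|e [w IH]]; first by exists 0%N; rewrite expn0 mul0n muln0.
exists (e * u ^ 2 + w + t * u * w)%N.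
by rewrite expnS IH; ring.
Qed.

(** This makes 2 a primitive root modulo 3^(l+1). Inductively d = 2 3^l e, and 2^d is 1 + e 3^(l+1)
    (3v+1) modulo 3^(2l+2), so the next power of 3 forces 3 to divide e. *)
Lemma order2_mod_exp3 l d : (3 ^ l.+1 %| 2 ^ d - 1)%N -> (2 * 3 ^ l %| d)%N.
Proof.
elim: l d => [|l IH] d.
  rewrite muln1 dvdn2 expn1 => H; apply/negP => od.
  (* For odd d, 2^d is 2 times a power of 4 = 1 + 3, hence 2 modulo 3. *)
  have dE := odd_double_half d.
  move: H; rewrite -dE od -muln2 mulnC expnD expnM expn1.
  have [w] := expn1D_mod_sqr 3 1 d./2.
  rewrite -[(1 + 3 * 1)%N]/(2 ^ 2)%N => ->.
  lia.
move=> H.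
have /dvdnP [e de] : (2 * 3 ^ l %| d)%N.
  by apply: IH; apply: dvdn_trans H; rewrite dvdn_exp2l.
move: H; rewrite de mulnC expnM.
have [v ->] := expn2_3adic l.
have [w ->] := expn1D_mod_sqr (3 ^ l.+1) (3 * v + 1) e.
rewrite -addnA addKn => H.
have : (3 ^ l.+2 %| 3 ^ l.+1 * (e * (3 * v + 1)))%N.
  have : (3 ^ l.+2 %| (3 ^ l.+1) ^ 2 * w)%N.
    by rewrite dvdn_mulr // -expnM dvdn_exp2l //; lia.
  by move=> /dvdn_addl Ha; rewrite mulnCA -Ha.
rewrite (expnS 3 l.+1) (mulnC 3) dvdn_pmul2l ?expn_gt0 // => H3.
have : (3 %| e)%N by move: H3; rewrite Euclid_dvdM // => /orP [//|]; lia.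
case/dvdnP => f ->; rewrite expnS; apply/dvdnP; exists f; ring.
Qed.

(** * Irreducibility of the 3^(l+1)-th cyclotomic polynomial over the field with two elements *)

Section CyclotomicThree.
Variable l : nat.
Let m := (3 ^ l)%N.

Definition Phi3 : {poly 'F_2} := 'X^2 + 'X + 1.
Definition Phi : {poly 'F_2} := Phi3 \Po 'X^m.

Lemma pow3_gt0 : (0 < m)%N. Proof. by rewrite expn_gt0. Qed.

Lemma PhiE : Phi = 'X^(2 * m) + 'X^m + 1.
Proof.
rewrite /Phi /Phi3 !(comp_polyD, comp_polyX, comp_Xn_poly).
by rewrite -polyC1 comp_polyC -exprM mulnC.
Qed.

Lemma size_Phi : size Phi = (2 * m).+1.
Proof.
have m0 := pow3_gt0.
rewrite PhiE -addrA size_polyDl size_polyXn // (leq_ltn_trans (size_polyD _ _)) //.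
rewrite size_polyXn size_poly1 gtn_max; lia.
Qed.

Lemma Phi_dvd : Phi %| 'X^(3 * m) - 1.
Proof.
apply/dvdpP; exists ('X^m - 1); rewrite PhiE !(mulnC _ m) !exprM.
by move: ('X^m) => t; ring.
Qed.

Lemma Fp2_neq0 (c : 'F_2) : c != 0 -> c = 1.
Proof. by case: c => [[|[|]]] //= i _; apply/val_inj. Qed.

Lemma poly_F2_monic (p : {poly 'F_2}) : p != 0 -> p \is monic.
Proof. by rewrite -lead_coef_eq0 monicE => /Fp2_neq0 ->. Qed.

(** A root [a] of q in the field with 2^(deg q) elements has order exactly 3^(l+1). Since [a] is
    fixed by the deg q-th power of Frobenius, 3^(l+1) divides 2^(deg q) - 1, so 2 3^l divides deg
    q. *)
Lemma irreducible_dvd_Phi (q : {poly 'F_2}) :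
  irreducible_poly q -> q %| Phi -> (2 * m < size q)%N.
Proof.
move=> qI qdvd.
have qmon : q \is monic by apply/poly_F2_monic/irredp_neq0.
have hI : monic_irreducible_poly q by split.
pose K := {poly %/ q with hI}.
pose f : {rmorphism {poly 'F_2} -> K} := in_qpoly q.
pose a : K := f 'X.
have mkq : mk_monic q = q by apply: mk_monicE.
have f0 p : (f p == 0) = (q %| p).
  by rewrite -val_eqE /= mkq -Pdiv.IdomainMonic.modpE.
have PhiK : a ^+ (2 * m) + a ^+ m + 1 = 0.
  by apply/eqP; rewrite -!rmorphXn -!rmorphD -(rmorph1 f) -rmorphD f0 -PhiE.
have a3 : a ^+ (3 ^ l.+1) = 1.
  have := dvdp_trans qdvd Phi_dvd.
  by rewrite -f0 rmorphB rmorph1 rmorphXn subr_eq0 expnS => /eqP.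
(* If a^m were 1, the relation [PhiK] would read 1 + 1 + 1 = 0, while this sum is 1 in
   characteristic 2. *)
have am : a ^+ m != 1.
  apply/eqP => am; move: PhiK; rewrite mulnC exprM am expr1n => /eqP.
  have -> : 1 + 1 + 1 = f (1 + 1 + 1) by rewrite !rmorphD rmorph1.
  have -> : 1 + 1 + 1 = 1 :> {poly 'F_2}.
    by rewrite -polyC1 -!polyCD; congr (_%:P); apply: val_inj.
  by rewrite rmorph1 oner_eq0.
have aC : a ^+ (2 ^ (size q).-1) = a.
  have := expf_card a. rewrite card_qfpoly card_Fp //.
have aU : a != 0.
  by apply/eqP => a0; move: a3; rewrite a0 expr0n expn_eq0 /= => /eqP; rewrite eq_sym oner_eq0.
have aP : (3 ^ l.+1).-primitive_root a.
  have [d dP ddvd] := prim_order_exists (expn_gt0 3 l.+1) a3.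
  move: ddvd dP => /(dvdn_pfactor _ _ (isT : prime 3)) [j].
  rewrite leq_eqVlt ltnS => /orP [/eqP -> -> //|jl -> dP].
  case/negP: am; rewrite -(prim_order_dvd dP) dvdn_exp2l //.
have : (3 ^ l.+1 %| 2 ^ (size q).-1 - 1)%N.
  rewrite (prim_order_dvd aP) -(inj_eq (mulfI aU)) mulr1 -exprS.
  by rewrite subn1 prednK ?expn_gt0 // aC.
move=> /order2_mod_exp3 /dvdn_leq.
have [+ _] := qI; rewrite -/m; case: (size q) => //= n n0.
by apply; lia.
Qed.
End CyclotomicThree.

Lemma irreducible_factor (R : finFieldType) (p : {poly R}) :
  (1 < size p)%N -> exists2 q, irreducible_poly q & q %| p.
Proof.
have [n] := ubnP (size p); elim: n p => // n IH p; rewrite ltnS => pn p1.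
have [pI|] := boolP (irreducibleb p); first by exists p => //; apply/irreducibleP.
rewrite /irreducibleb p1 /= negb_forall => /existsP [q].
rewrite negb_imply -ltnNge => /andP [qp q1].
have p0 : p != 0 by rewrite -size_poly_gt0 ltnW.
have qs := size_npoly q.
have [|r rI rq] := IH q _ q1.
  by apply: leq_ltn_trans qs _; rewrite -ltnS prednK ?size_poly_gt0.
by exists r => //; apply: dvdp_trans rq _; rewrite dvdpE.
Qed.

(** An irreducible factor of a nonconstant divisor is already as large as [Phi l], hence associated
    to it. *)
Lemma irreducible_Phi l : irreducible_poly (Phi l).
Proof.
have ml := expn_gt0 3 l.
split=> [|q q1 qP]; first by rewrite size_Phi; lia.
have P0 : Phi l != 0 by rewrite -size_poly_gt0 size_Phi.
have [|p pI pq] := @irreducible_factor _ q.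
  by rewrite ltn_neqAle eq_sym q1 size_poly_gt0 (dvdpN0 qP).
have pP := dvdp_trans pq qP.
have := irreducible_dvd_Phi pI pP; rewrite -size_Phi => /= sz.
apply/andP; split=> //; apply: dvdp_trans pq.
rewrite -(eqp_dvdl _ (_ : p %= Phi l)) //.
by rewrite -dvdp_size_eqp // eqn_leq dvdp_leq.
Qed.

(** * Divisors of powers of the cyclotomic polynomial *)

(** One factor P is cancelled from G or from H at each step. Equality holds, not just association,
    because 1 is the only nonzero constant. *)
Lemma dvd_irreducible_exp (P G H : {poly 'F_2}) N : irreducible_poly P ->
  G * H = P ^+ N -> exists t, G = P ^+ t.
Proof.
move=> PI; have P0 := irredp_neq0 PI; elim: N G H => [|N IH] G H.
  move=> GH; exists 0%N.
  have /size_poly1P [c c0 ->] : size G == 1%N by rewrite -dvdp1 -[1]GH dvdp_mulr.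
  by rewrite (Fp2_neq0 c0) expr0 polyC1.
rewrite exprS => GH.
have [PG|PG] := boolP (P %| G).
  have [G1 GE] := dvdpP _ _ PG.
  have [|t G1t] := IH G1 H.
    by apply: (mulfI P0); rewrite -GH GE; ring.
  by exists t.+1; rewrite GE G1t exprSr.
have PH : P %| H.
  rewrite -(Gauss_dvdpr _ (_ : coprimep P G)); first by rewrite GH dvdp_mulr.
  by rewrite irreducible_poly_coprime.
have [H1 HE] := dvdpP _ _ PH.
by apply: (IH G H1); apply: (mulfI P0); rewrite -GH HE; ring.
Qed.

(** A power of [Phi l] is still a polynomial in X^(3^l). *)
Lemma Phi_exp_support l t j : (Phi l ^+ t)`_j != 0 -> (3 ^ l %| j)%N.
Proof.
rewrite /Phi -rmorphXn /= coef_comp_poly_Xn ?expn_gt0 //.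
by case: ifP => //; rewrite eqxx.
Qed.

Lemma Phi3_frobenius k N :
  ('X^(2 * N) + 'X^N + 1 : {poly 'F_2}) ^+ (2 ^ k) =
    'X^(2 * (2 ^ k * N)) + 'X^(2 ^ k * N) + 1.
Proof.
have c : 2%N \in [pchar {poly 'F_2}] by rewrite pchar_poly; apply: pchar_Fp.
have e : [pchar {poly 'F_2}].-nat (2 ^ k)%N.
  by rewrite pnatX; apply/orP; left; rewrite pnatE.
by rewrite !exprDn_pchar // expr1n -!exprM -mulnA ![(_ * 2 ^ k)%N]mulnC.
Qed.

Lemma dvd_cyclotomic3_support k (G H : {poly 'F_2}) j :
  G * H = 'X^(2 * 6 ^ k) + 'X^(6 ^ k) + 1 -> G`_j != 0 -> (3 ^ k %| j)%N.
Proof.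
have -> : 'X^(2 * 6 ^ k) + 'X^(6 ^ k) + 1 = Phi k ^+ (2 ^ k).
  by rewrite PhiE Phi3_frobenius (expnMn 2 3).
move=> /(dvd_irreducible_exp (irreducible_Phi k)) [t ->].
exact: Phi_exp_support.
Qed.

(** * Passage from the algebra to polynomials in y = x^(1/6^k) *)

Lemma in_alg_mul f g s : (s \in alg_mul f g) = (conv_coef f g s != 0).
Proof.
rewrite /alg_mul !inE /= andb_idl // => c0.
apply: contraNT c0 => nfg; apply/eqP.
rewrite /conv_coef big_seq big1 // => a af; rewrite big_seq big1 // => b bg.
case: eqP => // abs; case/negP: nfg; rewrite -abs.
exact: (in_imfset2 _ (fun a b : rat => a + b)).
Qed.

Lemma alg_mul_sub f g s : s \in alg_mul f g ->
  exists a b, [/\ a \in f, b \in g & s = a + b].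
Proof.
rewrite /alg_mul !inE /= => /andP [/imfset2P [a /= af [b /= bg ->]] _].
by exists a, b.
Qed.

Definition frac6 k (s : rat) := exists n : nat , s = n%:R / 6 ^+ k.

Lemma pow6_neq0 k : 6 ^+ k != 0 :> rat.
Proof. by rewrite expf_neq0. Qed.

Lemma frac6W k1 k2 s : (k1 <= k2)%N -> frac6 k1 s -> frac6 k2 s.
Proof.
move=> k12 [n ->]; exists (n * 6 ^ (k2 - k1))%N.
rewrite natrM natrX -(subnK k12) exprD addnK.
by rewrite invfM mulrA mulfK ?pow6_neq0.
Qed.

(** The exponent of y that corresponds to x^s; truncation loses nothing when s satisfies
    [frac6 k]. *)
Definition num k (s : rat) : nat := Num.truncn (s * 6 ^+ k).

Lemma frac6E k s : frac6 k s -> s = (num k s)%:R / 6 ^+ k.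
Proof. by move=> [n ->]; rewrite /num divfK ?pow6_neq0 // natrK. Qed.

Lemma num_nat k n : num k (n%:R / 6 ^+ k) = n.
Proof. by rewrite /num divfK ?pow6_neq0 // natrK. Qed.

Lemma numD k a b : frac6 k a -> frac6 k b -> num k (a + b) = (num k a + num k b)%N.
Proof. by move=> [n ->] [p ->]; rewrite -mulrDl -natrD !num_nat. Qed.

Lemma num_inj k a b : frac6 k a -> frac6 k b -> num k a = num k b -> a = b.
Proof. by move=> /frac6E -> /frac6E ->; rewrite !num_nat => ->. Qed.

Definition toPoly k (f : {fset rat}) : {poly 'F_2} := \sum_(s <- f) 'X^(num k s).

Lemma coef_toPoly k (f : {fset rat}) (s : rat) : Defs.in_alg (frac6 k) f -> frac6 k s ->
  (toPoly k f)`_(num k s) = (s \in f)%:R.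
Proof.
move=> fk sk; rewrite /toPoly coef_sum.
under eq_big_seq => t tf.
  have -> : 'X^(num k t)`_(num k s) = (t == s)%:R :> 'F_2.
    rewrite coefXn; congr (_%:R); congr nat_of_bool.
    by apply/eqP/eqP => [/num_inj ->|->] //; apply: fk.
over.
have [sf|sf] := boolP (s \in f).
  by rewrite (bigD1_seq s) ?fset_uniq //= eqxx big1 ?addr0 // => t /negbTE ->.
by rewrite big_seq big1 // => t tf; case: eqP => // ts; rewrite -ts tf in sf.
Qed.

Lemma toPoly_inj k f g : Defs.in_alg (frac6 k) f -> Defs.in_alg (frac6 k) g ->
  toPoly k f = toPoly k g -> f = g.
Proof.
move=> fk gk fg.
have aux f1 g1 s : Defs.in_alg (frac6 k) f1 -> Defs.in_alg (frac6 k) g1 ->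
    toPoly k f1 = toPoly k g1 -> s \in f1 -> s \in g1.
  move=> fk1 gk1 e sf; have sk := fk1 _ sf.
  have := coef_toPoly fk1 sk; rewrite e coef_toPoly // sf.
  by case: (s \in g1) => // /eqP; rewrite eq_sym oner_eq0.
by apply/fsetP => s; apply/idP/idP; apply: aux.
Qed.

(** Together with injectivity, this embeds the elements with exponents in the grid of step 1/6^k
    into a polynomial ring. *)
Lemma toPolyM k f g : Defs.in_alg (frac6 k) f -> Defs.in_alg (frac6 k) g ->
  toPoly k (alg_mul f g) = toPoly k f * toPoly k g.
Proof.
move=> fk gk; rewrite /toPoly.
(* Weighting by the coefficient allows the sum over the product's support to be extended by zero
   terms to all sums a + b. *)
pose F s : {poly 'F_2} := (conv_coef f g s)%:P * 'X^(num k s).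
pose S := [fset (a + b)%R | a in f, b in g]%fset.
have sub : (alg_mul f g `<=` S)%fset by apply: fset_sub.
have -> : \sum_(s <- alg_mul f g) 'X^(num k s) = \sum_(s <- alg_mul f g) F s.
  apply: eq_big_seq => s; rewrite in_alg_mul /F => /Fp2_neq0 ->.
  by rewrite polyC1 mul1r.
rewrite (big_fset_incl _ sub) /=; last first.
  move=> s _; rewrite in_alg_mul negbK /F => /eqP ->.
  by rewrite polyC0 mul0r.
rewrite /F /conv_coef.
under eq_bigr => s _.
  rewrite rmorph_sum mulr_suml.
  under eq_bigr do rewrite rmorph_sum mulr_suml.
over.
rewrite exchange_big mulr_suml /=; apply: eq_big_seq => a af.
rewrite exchange_big mulr_sumr /=; apply: eq_big_seq => b bg.
have abS : a + b \in S by apply: (in_imfset2 _ (fun a b : rat => a + b)).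
rewrite (bigD1_seq (a + b)) ?fset_uniq //= eqxx polyC1 mul1r big1 ?addr0; last first.
  by move=> s; rewrite eq_sym => /negbTE ->; rewrite polyC0 mul0r.
by rewrite numD ?exprD //; [apply: fk|apply: gk].
Qed.

Lemma toPoly1 k : toPoly k alg_one = 1.
Proof. by rewrite /toPoly /alg_one big_seq_fset1 /num mul0r truncn0 expr0. Qed.

(** * Square roots in characteristic 2 *)

(** Off-diagonal terms occur in equal pairs and cancel. *)
Lemma sum_sym_F2 (I : Type) (r : seq I) (F : I -> I -> 'F_2) :
  (forall i j, F i j = F j i) ->
  \sum_(i <- r) \sum_(j <- r) F i j = \sum_(i <- r) F i i.
Proof.
move=> sF; elim: r => [|i r IH]; first by rewrite !big_nil.
rewrite big_cons big_cons [in RHS]big_cons -IH -addrA; congr (_ + _).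
under [X in _ + X]eq_bigr => j _ do rewrite big_cons sF.
rewrite big_split /= addrA; set x := \sum_(j <- r) F i j.
suff -> : x + x = 0 by rewrite add0r.
by case: x => [[|[|]]] //= ?; apply/val_inj.
Qed.

Lemma alg_sqr (g : {fset rat}) :
  alg_mul [fset s / 2 | s in g]%fset [fset s / 2 | s in g]%fset = g.
Proof.
apply/fsetP => s; rewrite in_alg_mul /conv_coef sum_sym_F2; last first.
  by move=> i j; rewrite addrC.
rewrite big_imfset /=; last by move=> x y _ _; lra.
under eq_bigr => x _ do have -> : x / 2 + x / 2 = x by lra.
have [sg|sg] := boolP (s \in g).
  rewrite (bigD1_seq s) ?fset_uniq //= eqxx big1 ?addr0 // => t /negbTE ->.
  by [].
rewrite big_seq big1 ?eqxx // => t tg; case: eqP => // ts.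
by rewrite -ts tg in sg.
Qed.

(** * 3-adic independence of the perturbations *)

(** Exponents of 3 whose gaps m + 2 grow, so that 3^(m+2) exceeds the coefficients that can occur at
    index m. *)
Definition level m : nat := \sum_(i < m) (i + 2)%N.

Lemma levelS m : level m.+1 = (level m + (m + 2))%N.
Proof. by rewrite /level big_ord_recr. Qed.

Definition eps m : rat := (3 ^+ level m.+1)^-1.

Lemma leq_level m : (m <= level m)%N.
Proof. by elim: m => // m IH; rewrite levelS; lia. Qed.

Lemma pow_neq0 n k : n.+1%:R ^+ k != 0 :> rat.
Proof. by rewrite expf_neq0 // pnatr_eq0. Qed.

Lemma eps_gt0 m : 0 < eps m.
Proof. by rewrite invr_gt0 exprn_gt0. Qed.

Lemma eps_le m : eps m <= (2 ^+ m.+1)^-1.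
Proof.
rewrite lef_pV2 ?posrE ?exprn_gt0 //.
apply: (@le_trans _ _ (3 ^+ m.+1)); first by rewrite lerXn2r // nnegrE.
by rewrite ler_eXn2l // leq_level.
Qed.

Lemma eps_sum_denominator K (d : nat -> int) :
  exists z : int, \sum_(m < K) (d m)%:~R * eps m = z%:~R / 3 ^+ level K.
Proof.
elim: K => [|K [z IH]]; first by exists 0; rewrite big_ord0 mul0r.
exists (z * 3 ^+ (K + 2) + d K); rewrite big_ord_recr /= IH /eps levelS exprD.
rewrite intrD intrM rmorphXn /= mulrDl invfM; congr (_ + _).
by rewrite mulrACA divff ?mulr1 // (pow_neq0 2).
Qed.

Lemma eps_independent K (d : nat -> int) (z : int) k :
  (forall m, `|d m| < 3 ^+ (m + 2)) ->
  \sum_(m < K) (d m)%:~R * eps m = z%:~R / 2 ^+ k ->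
  forall m, (m < K)%N -> d m = 0.
Proof.
move=> dlt; elim: K => // K IH; rewrite big_ord_recr /=.
have [y yE] := eps_sum_denominator K d; rewrite {1}yE => H.
have dK : d K = 0.
  have E : 2 ^+ k * (y * 3 ^+ (K + 2) + d K) = z * 3 ^+ level K * 3 ^+ (K + 2).
    apply: (@intr_inj rat); move: H; rewrite /eps levelS exprD.
    rewrite !intrM !intrD !intrM !rmorphXn /=.
    have := pow_neq0 1 k; have := pow_neq0 2 (level K); have := pow_neq0 2 (K + 2).
    move: (3 ^+ (K + 2)) (3 ^+ level K) (2 ^+ k) => u v w u0 v0 w0 H.
    have -> : w * (y%:~R * u + (d K)%:~R) = w * u * v * (y%:~R / v + (d K)%:~R * (v * u)^-1).
      by field; rewrite u0 v0.
    by rewrite H; field.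
  have : (3 ^+ (K + 2) %| d K)%Z.
    rewrite -(@Gauss_dvdzr _ (2 ^+ k)) ?coprimezXl ?coprimezXr //.
    have -> : 2 ^+ k * d K = (z * 3 ^+ level K - 2 ^+ k * y) * 3 ^+ (K + 2).
      rewrite mulrBl -E; move: (3 ^+ _) (2 ^+ _) => u v; ring.
    by rewrite dvdz_mull.
  move=> /dvdzP [c cE]; have := dlt K; rewrite cE.
  have [-> _|c0] := eqVneq c 0; first exact: mul0r.
  rewrite normrM normrX -[X in _ < X]mul1r ltr_pM2r ?exprn_gt0 //.
  by lia.
move=> m; rewrite ltnS leq_eqVlt => /orP [/eqP -> //|]; apply: IH.
by rewrite -H dK mul0r addr0.
Qed.

Definition dyadic (x : rat) := exists (z : int) k, x = z%:~R / 2 ^+ k.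

Lemma dyadicB x y : dyadic x -> dyadic y -> dyadic (x - y).
Proof.
move=> [z [k ->]] [w [l ->]]; exists (z * 2 ^+ l - w * 2 ^+ k), (k + l)%N.
rewrite exprD intrB !intrM !rmorphXn /=.
have := pow_neq0 1 k; have := pow_neq0 1 l.
by move: (2 ^+ l) (2 ^+ k) => u v u0 v0; field; rewrite u0 v0.
Qed.

Lemma dyadic_sum (I : Type) (r : seq I) (F : I -> nat) :
  dyadic (\sum_(i <- r) (2 ^+ F i)^-1).
Proof.
elim: r => [|i r IH]; first by exists 0, 0%N; rewrite big_nil mul0r.
rewrite big_cons addrC -[X in _ + X]opprK; apply: dyadicB => //.
by exists (-1), (F i); rewrite mulN1r.
Qed.

(** * The generators and their relations *)

Definition sgn (p : nat * bool) : int := if p.2 then 1 else -1.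
Definition gen (p : nat * bool) : rat := (2 ^+ p.1)^-1 + (sgn p)%:~R * eps p.1.

Lemma gen_ge p : (2 ^+ p.1.+1)^-1 <= gen p.
Proof.
case: p => m b; rewrite /gen /sgn /=.
have := eps_gt0 m; have := eps_le m; rewrite exprS invfM.
case: b; lra.
Qed.

Lemma gen_gt0 p : 0 < gen p.
Proof. by apply: lt_le_trans (gen_ge p); rewrite invr_gt0 exprn_gt0. Qed.

Lemma gen_le2 p : gen p <= 2.
Proof.
case: p => m b; rewrite /gen /sgn /=.
have := eps_gt0 m; have := eps_le m; rewrite exprS invfM.
have : (2 ^+ m)^-1 <= 1 :> rat by rewrite invf_le1 ?exprn_gt0 // exprn_ege1.
case: b; lra.
Qed.

Lemma sum_gen_ge0 s : 0 <= \sum_(q <- s) gen q.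
Proof. by apply: sumr_ge0 => q _; rewrite ltW ?gen_gt0. Qed.

(** Each generator of index m is at least 2^-(m+1), so at most 2^(m+2) of them fit into a sum
    bounded by 2. *)
Lemma count_level_le s m : \sum_(q <- s) gen q <= 2 ->
  (count (fun q => q.1 == m) s <= 2 ^ (m + 2))%N.
Proof.
move=> H; rewrite -(ler_nat rat).
have : \sum_(q <- s | q.1 == m) (2 ^+ m.+1)^-1 <= 2 :> rat.
  apply: le_trans H; rewrite [leRHS](bigID (fun q => q.1 == m)) /=.
  apply: ler_wpDr; first by apply: sumr_ge0 => q _; rewrite ltW ?gen_gt0.
  by apply: ler_sum => q /eqP <-; apply: gen_ge.
rewrite big_const_seq iter_addr_0 -[_^-1 *+ _]mulr_natl ler_pdivrMr ?exprn_gt0 //.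
by rewrite natrX addn2 -exprS.
Qed.

Lemma pow23 m : (2 ^ (m + 2) + 1 < 3 ^ (m + 2))%N.
Proof. by elim: m => // m IH; rewrite addSn !expnS; lia. Qed.

(** The key to atomicity: a generator can only be written as a sum that contains it. Comparing the
    two sides, the perturbations add up to a dyadic number, so their coefficients vanish index by
    index. *)
Lemma gen_mem_sum p s : gen p = \sum_(q <- s) gen q -> p \in s.
Proof.
move=> E.
(* The net coefficient of [eps m] when the generator is subtracted from the sum. *)
pose d m : int := \sum_(q <- s) (q.1 == m)%:R * sgn q - (p.1 == m)%:R * sgn p.
pose K := (\max_(q <- p :: s) q.1).+1.
have qK q : q \in p :: s -> (q.1 < K)%N by move=> qs; rewrite ltnS leq_bigmax_seq.
have sE q : q \in p :: s ->
    \sum_(m < K) ((q.1 == m)%:R * sgn q)%:~R * eps m = (sgn q)%:~R * eps q.1.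
  move=> qs; rewrite (bigD1 (Ordinal (qK _ qs))) //= eqxx mul1r big1 ?addr0 // => m.
  by rewrite -val_eqE /= eq_sym => /negbTE ->; rewrite !mul0r.
have dsum : \sum_(m < K) (d m)%:~R * eps m =
    (2 ^+ p.1)^-1 - \sum_(q <- s) (2 ^+ q.1)^-1.
  under eq_bigr do rewrite /d intrB mulrBl.
  rewrite sumrB sE ?mem_head //.
  under eq_bigr do rewrite rmorph_sum mulr_suml.
  rewrite exchange_big /=.
  have -> : \sum_(q <- s) \sum_(m < K) ((q.1 == m)%:R * sgn q)%:~R * eps m
     = \sum_(q <- s) (gen q - (2 ^+ q.1)^-1).
    by apply: eq_big_seq => q qs; rewrite sE ?inE ?qs ?orbT // /gen; ring.
  by rewrite sumrB -E /gen; ring.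
have [z [k zk]] : dyadic ((2 ^+ p.1)^-1 - \sum_(q <- s) (2 ^+ q.1)^-1).
  apply: dyadicB; last exact: dyadic_sum.
  by exists 1, p.1; rewrite mul1r.
have sgn1 q : `|sgn q| = 1 by rewrite /sgn; case: q.2.
(* At most 2^(m+2) summands of index m, plus one for p itself, stay below 3^(m+2). *)
have dlt m : `|d m| < 3 ^+ (m + 2).
  have c := count_level_le m (_ : \sum_(q <- s) gen q <= 2).
  rewrite -E gen_le2 in c; move: (c isT) (pow23 m) => {}c c2.
  apply: (@le_lt_trans _ _ (count (fun q => q.1 == m) s + 1)%N%:R).
    apply: (le_trans (ler_normB _ _)); rewrite natrD lerD //.
      apply: (le_trans (ler_norm_sum _ _ _)); rewrite -sum1_count natr_sum [leRHS]big_mkcond /=.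
      by apply: ler_sum => q _; case: eqP => _; rewrite ?mul1r ?sgn1 ?mul0r ?normr0.
    by case: eqP => _; rewrite ?mul1r ?sgn1 ?mul0r ?normr0.
  by rewrite -natrX ltr_nat; lia.
have := eps_independent dlt (etrans dsum zk) (qK _ (mem_head _ _)).
apply: contraPT => ps; rewrite /d eqxx mul1r.
(* If p is missing from s, all summands of its index have the opposite sign, so they reinforce the
   term of p instead of cancelling it. *)
have -> : \sum_(q <- s) (q.1 == p.1)%:R * sgn q = - (count (fun q => q.1 == p.1) s)%:R * sgn p.
  rewrite -sum1_count natr_sum mulNr mulr_suml -sumrN [RHS]big_mkcond /=.
  apply: eq_big_seq => q qs; case: eqP => qp; rewrite ?mul0r // !mul1r.
  move: ps qs qp; case: p q {E d K qK sE dsum zk dlt} => [m b] [n c] /= ps qs nm; rewrite nm in qs.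
  by rewrite /sgn /=; case: b ps; case: c qs => // -> .
by rewrite /sgn; case: p.2; lia.
Qed.

(** * The monoid and its atoms *)

Definition genMonoid (x : rat) := exists s : seq (nat * bool), x = \sum_(q <- s) gen q.

Lemma genMonoid_gen p : genMonoid (gen p).
Proof. by exists [:: p]; rewrite big_seq1. Qed.

Lemma genMonoid_puiseux : puiseux_monoid genMonoid.
Proof.
split; first by exists [::]; rewrite big_nil.
  by move=> _ _ [s ->] [t ->]; exists (s ++ t); rewrite big_cat.
by move=> _ [s ->]; apply: sum_gen_ge0.
Qed.

Lemma mem_gen_le p s : p \in s -> gen p <= \sum_(q <- s) gen q.
Proof.
move=> ps; rewrite (perm_big _ (perm_to_rem ps)) big_cons /= lerDl.
exact: sum_gen_ge0.
Qed.

(** In a decomposition x + y, the generator occurs inside x or y; that part is then at least the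
    whole, and the other is 0. *)
Lemma gen_atom p : monoid_atom genMonoid (gen p).
Proof.
split; [exact: genMonoid_gen|by rewrite gt_eqF ?gen_gt0|].
move=> _ _ [s ->] [t ->] E.
have := sum_gen_ge0 s; have := sum_gen_ge0 t.
have : p \in s ++ t by apply: gen_mem_sum; rewrite big_cat.
rewrite mem_cat => /orP [] /mem_gen_le; [right|left]; lra.
Qed.

Lemma genMonoid_atomic : atomic_monoid genMonoid.
Proof.
move=> _ [s ->] _; exists (map gen s); split; last by rewrite big_map.
by move=> _ /mapP [p _ ->]; apply: gen_atom.
Qed.

Lemma genMonoid_nat_pow2 n k : genMonoid (n%:R / 2 ^+ k).
Proof.
have [M0 MD _] := genMonoid_puiseux.
elim: n => [|n IH]; first by rewrite mul0r.
rewrite -addn1 natrD mulrDl; apply: (MD) => //.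
have -> : 1 / 2 ^+ k = gen (k.+1, true) + gen (k.+1, false).
  by rewrite /gen /sgn /= exprS invfM; lra.
by apply: MD; apply: genMonoid_gen.
Qed.

(** * Common denominators and units *)

Lemma frac6D k a b : frac6 k a -> frac6 k b -> frac6 k (a + b).
Proof. by move=> [n ->] [p ->]; exists (n + p)%N; rewrite natrD mulrDl. Qed.

Lemma gen_frac6 p : exists k, frac6 k (gen p).
Proof.
case: p => m b; exists (m + level m.+1)%N; set L := level m.+1.
have : gen (m, b) * 6 ^+ (m + L) \is a Num.nat.
  rewrite natrEint mulr_ge0 ?exprn_ge0 ?(ltW (gen_gt0 _)) // andbT.
  have -> : gen (m, b) * 6 ^+ (m + L) =
      2 ^+ L * 3 ^+ (m + L) + (sgn (m, b))%:~R * (2 ^+ (m + L) * 3 ^+ m).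
    rewrite /gen /eps -/L /= -[6]/(2 * 3)%:R natrM !exprMn !exprD.
    have := pow_neq0 1 m; have := pow_neq0 2 L.
    by move: (2 ^+ m) (3 ^+ L) => u v u0 v0; field; rewrite u0 v0.
  by rewrite rpredD ?rpredM ?rpredX ?intr_int ?rpred_nat.
move=> /natrP [n nE]; exists n; apply: (canRL (mulfK _)) => //.
exact: pow6_neq0.
Qed.

Lemma genMonoid_frac6 x : genMonoid x -> exists k, frac6 k x.
Proof.
move=> [s ->]; elim: s => [|q s [k IH]]; first by exists 0%N, 0%N; rewrite big_nil mul0r.
have [l lq] := gen_frac6 q; exists (maxn k l); rewrite big_cons.
by apply: frac6D; [apply: frac6W lq|apply: frac6W IH]; rewrite ?leq_maxl ?leq_maxr.
Qed.

(** Stated for all large k so that two elements can be placed on the same grid. *)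
Lemma in_alg_frac6 (f : {fset rat}) : Defs.in_alg genMonoid f ->
  exists k0, forall k, (k0 <= k)%N -> Defs.in_alg (frac6 k) f.
Proof.
have aux (r : seq rat) : (forall s, s \in r -> genMonoid s) ->
    exists k0, forall k, (k0 <= k)%N -> forall s, s \in r -> frac6 k s.
  elim: r => [_|x r IH rM]; first by exists 0%N.
  have [|k kr] := IH; first by move=> s sr; apply: rM; rewrite inE sr orbT.
  have [l lx] := genMonoid_frac6 (rM x (mem_head _ _)).
  exists (maxn k l) => n; rewrite geq_max => /andP [kn ln] s.
  by rewrite inE => /orP [/eqP ->|/kr]; [apply: frac6W lx|apply].
exact: (aux (enum_fset f)).
Qed.

(** On a common grid, a unit and its inverse become polynomials with product 1, hence constants, and
    the only nonzero constant is 1. *)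
Lemma alg_unit_one (u : {fset rat}) : alg_unit genMonoid u -> u = alg_one.
Proof.
move=> [uM [v [vM uv]]].
have [k1 uk] := in_alg_frac6 uM; have [k2 vk] := in_alg_frac6 vM.
pose k := maxn k1 k2.
have {}uk : Defs.in_alg (frac6 k) u by apply: uk; rewrite leq_maxl.
have {}vk : Defs.in_alg (frac6 k) v by apply: vk; rewrite leq_maxr.
have uv1 : toPoly k u * toPoly k v = 1 by rewrite -toPolyM // uv toPoly1.
have /size_poly1P [c c0 uc] : size (toPoly k u) == 1%N by rewrite -dvdp1 -uv1 dvdp_mulr.
apply: (@toPoly_inj k) => //.
  by move=> s; rewrite inE => /eqP ->; exists 0%N; rewrite mul0r.
by rewrite toPoly1 uc (Fp2_neq0 c0) polyC1.
Qed.

Lemma alg_one1 : alg_mul alg_one alg_one = alg_one.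
Proof.
rewrite -[RHS](alg_sqr alg_one); set u := [fset _ | _ in _]%fset.
suff -> : u = alg_one by [].
by rewrite /u imfset_fset1 mul0r.
Qed.

Lemma alg_one_in : Defs.in_alg genMonoid alg_one.
Proof. by have [M0 _ _] := genMonoid_puiseux; move=> s; rewrite inE => /eqP ->. Qed.

Lemma alg_mul_in g h : Defs.in_alg genMonoid g -> Defs.in_alg genMonoid h ->
  Defs.in_alg genMonoid (alg_mul g h).
Proof.
have [_ MD _] := genMonoid_puiseux.
by move=> gM hM s /alg_mul_sub [a [b [ag bh ->]]]; apply: MD; [apply: gM|apply: hM].
Qed.

Lemma alg_prod_in l : (forall g, g \in l -> Defs.in_alg genMonoid g) ->
  Defs.in_alg genMonoid (alg_prod l).
Proof.
elim: l => [_|g l IH lM] /=; first exact: alg_one_in.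
apply: alg_mul_in; first by apply: lM; rewrite mem_head.
by apply: IH => h hl; apply: lM; rewrite inE hl orbT.
Qed.

(** * Factors of 1 + x + x^2 and failure of atomicity *)

Definition trinomial : {fset rat} := [fset 0; 1; 2]%fset.

Lemma toPoly_trinomial k : toPoly k trinomial = 'X^(2 * 6 ^ k) + 'X^(6 ^ k) + 1.
Proof.
have numn n : num k n%:R = (n * 6 ^ k)%N by rewrite /num -natrX -natrM natrK.
rewrite /toPoly (perm_big [:: 2%:R; 1%:R; 0%:R]) /=; last first.
  by apply: uniq_perm => [||s]; rewrite ?fset_uniq // !inE -orbA orbC orbAC orbC.
by rewrite !big_cons big_nil addr0 !numn mul0n mul1n expr0 addrA.
Qed.

(** On a common grid the exponent of y is a multiple n 3^k, and n 3^k / 6^k = n / 2^k. *)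
Lemma trinomial_factor_dyadic g h s :
  Defs.in_alg genMonoid g -> Defs.in_alg genMonoid h ->
  alg_mul g h = trinomial -> s \in g -> exists n k, s = n%:R / 2 ^+ k.
Proof.
move=> gM hM gh sg.
have [k1 gk] := in_alg_frac6 gM; have [k2 hk] := in_alg_frac6 hM.
pose k := maxn k1 k2.
have {}gk : Defs.in_alg (frac6 k) g by apply: gk; rewrite leq_maxl.
have {}hk : Defs.in_alg (frac6 k) h by apply: hk; rewrite leq_maxr.
have GH := toPolyM gk hk; rewrite gh toPoly_trinomial in GH.
have := dvd_cyclotomic3_support (esym GH) (_ : _`_(num k s) != 0).
rewrite (coef_toPoly gk (gk _ sg)) sg => /(_ isT) /dvdnP [n nE].
exists n, k; rewrite (frac6E (gk _ sg)) nE natrM natrX.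
rewrite -[6]/(2 * 3)%:R natrM exprMn invfM mulrACA divff ?mulr1 //.
exact: pow_neq0.
Qed.

Lemma genMonoid_alg_not_atomic : ~ alg_atomic genMonoid.
Proof.
move=> atomic.
have tM : Defs.in_alg genMonoid trinomial.
  have natM n : genMonoid n%:R by have := genMonoid_nat_pow2 n 0; rewrite expr0 divr1.
  move=> s; rewrite !inE => /orP [/orP[]|] /eqP ->; [exact: (natM 0%N)|exact: (natM 1%N)|].
  exact: (natM 2%N).
have t1 : trinomial <> alg_one.
  by move=> /fsetP /(_ 1); rewrite !inE.
have t0 : trinomial != alg_zero by apply/fset0Pn; exists 0; rewrite !inE.
have [[|g l] [irr tE]] := atomic _ tM t0 (fun u => t1 (alg_unit_one u)); first exact: t1.
have [gM g0 gU gI] := irr g (mem_head _ _).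
have lM : Defs.in_alg genMonoid (alg_prod l).
  by apply: alg_prod_in => h hl; have [|] := irr h; rewrite ?inE ?hl ?orbT.
(* The square root of the first irreducible factor g. It lies in the algebra, so irreducibility
   makes it a unit, hence 1; then g = 1 would be a unit as well. *)
pose u : {fset rat} := [fset s / 2 | s in g]%fset.
have uM : Defs.in_alg genMonoid u.
  move=> _ /imfsetP [s /= sg ->].
  have [n [k ->]] := trinomial_factor_dyadic gM lM (esym tE) sg.
  by rewrite -mulrA -invfM -exprSr; apply: genMonoid_nat_pow2.
apply: gU.
have uu : alg_mul u u = g := alg_sqr g.
have u1 : u = alg_one by case: (gI u u uM uM (esym uu)) => /alg_unit_one.
rewrite -uu u1 alg_one1; split; first exact: alg_one_in.
by exists alg_one; split; [exact: alg_one_in|exact: alg_one1].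
Qed.

Theorem theorem5p4 :
  exists M : rat -> Prop,
    [/\ puiseux_monoid M, atomic_monoid M & ~ alg_atomic M].
Proof.
exists genMonoid; split.
- exact: genMonoid_puiseux.
- exact: genMonoid_atomic.
- exact: genMonoid_alg_not_atomic.
Qed.
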